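(* Let $\mathbb{F}\in\{\mathbb{R},\mathbb{C}\}$, let $(X,\Sigma,P)$ be a probability space, and let $\mathcal{H}\subseteq\mathbb{F}^X$ be a separable reproducing kernel Hilbert space whose reproducing kernel $K\colon X\times X\to\mathbb{F}$ is measurable. Let $P_K$ be the measure on $(X,\Sigma)$ defined by $dP_K(x)=K(x,x)\,dP(x)$. Let $\lambda\colon X\to\mathbb{F}$ be a measurable function such that the integral $\int_X|\lambda(x)|^2\,dP_K(x)$ is finite. Then the Bochner integral $$\int_X\lambda(x)K_x\,dP(x)$$ exists in $\mathcal{H}$. In addition, the mapping $$L^2(X;P_K)\ni\lambda\mapsto L_{P,K}\lambda:=\int_X\lambda(x)K_x\,dP(x)\in\mathcal{H}$$ is a nonexpansive (that is, $\|L_{P,K}\lambda\|_{\mathcal{H}}\le\|\lambda\|_{L^2(X;P_K)}$ for all $\lambda$), hence bounded, linear operator.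
   Context: A Hilbert space $\mathcal{H}\subseteq\mathbb{F}^X$ of functions on $X$ is a reproducing kernel Hilbert space (RKHS) with reproducing kernel $K$ if, writing $K_p:=K(\cdot,p)$, one has $K_p\in\mathcal{H}$ and $f(p)=\langle f,K_p\rangle$ for all $p\in X$ and $f\in\mathcal{H}$. Measurability of $K$ is with respect to the product $\sigma$-algebra $\Sigma\otimes\Sigma$. A function from a measure space to a Banach space is Bochner integrable if it is strongly measurable (measurable with separable range) and its norm is integrable. *)

(* Defs.v *)
From HB Require Import structures.
From mathcomp Require Import all_boot all_order all_algebra.
From mathcomp Require Import sesquilinear generic_quotient ring_quotient.
From mathcomp Require Import complex.
From mathcomp Require Import all_classical all_reals all_analysis.
From mathcomp Require Import measurable_realfun ring.

Set Implicit Arguments.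
Unset Strict Implicit.
Unset Printing Implicit Defensive.

Import Order.TTheory GRing.Theory Num.Theory.
Import numFieldNormedType.Exports.

Local Open Scope classical_set_scope.
Local Open Scope ring_scope.

Inductive scalar_kind := RealScalar | ComplexScalar.

Definition scalarF (R : realType) (k : scalar_kind) : numFieldType :=
  match k with RealScalar => R | ComplexScalar => R[i] end.

Section scalarF.
Context (R : realType) (k : scalar_kind).
Local Notation F := (scalarF R k).

Definition sembed : R -> F :=
  match k return R -> scalarF R k with
  | RealScalar => id | ComplexScalar => fun r => r%:C%C end.

Definition sre : F -> R :=
  match k return scalarF R k -> R with
  | RealScalar => id | ComplexScalar => @complex.Re R end.

Definition sconj : F -> F :=
  match k return scalarF R k -> scalarF R k with
  | RealScalar => id | ComplexScalar => @conjc R end.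

(* In MathComp the norm of a normed module over [F] takes its values in [F],
   where it is a nonnegative real; [rnorm] is the same norm valued in [R].
   At [V := F] it is the modulus. *)
Definition rnorm (V : normedZmodType F) (v : V) : R := sre `|v|.

Lemma sembedK : cancel sembed sre. Proof. by rewrite /sembed /sre; case: k. Qed.

Lemma sreK (x : F) : 0 <= x -> sembed (sre x) = x.
Proof.
rewrite /sembed /sre; case: k x => //= -[a b].
by rewrite lecE/= => /andP[/eqP -> _].
Qed.

Lemma sembed_le (a b : R) : (sembed a <= sembed b) = (a <= b).
Proof. by rewrite /sembed; case: k => //; rewrite lecR. Qed.

Lemma sembed_lt (a b : R) : (sembed a < sembed b) = (a < b).
Proof. by rewrite /sembed; case: k => //; rewrite ltcR. Qed.

Lemma sembedD (a b : R) : sembed (a + b) = sembed a + sembed b.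
Proof. by rewrite /sembed; case: k => //; rewrite rmorphD. Qed.

Lemma sembedM (a b : R) : sembed (a * b) = sembed a * sembed b.
Proof. by rewrite /sembed; case: k => //; rewrite rmorphM. Qed.

Lemma sembed0 : sembed 0 = 0. Proof. by rewrite /sembed; case: k. Qed.

Lemma sre_ge0 (x : F) : 0 <= x -> 0 <= sre x.
Proof. by move=> x0; rewrite -sembed_le sreK// sembed0. Qed.

Lemma rnormE (V : normedZmodType F) (v : V) : sembed (rnorm v) = `|v|.
Proof. by rewrite sreK. Qed.

Lemma rnorm_ge0 (V : normedZmodType F) (v : V) : 0 <= rnorm v.
Proof. exact: sre_ge0. Qed.

Lemma rnorm0 (V : normedZmodType F) : rnorm (0 : V) = 0.
Proof. by rewrite /rnorm normr0 -sembed0 sembedK. Qed.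

Lemma rnormN (V : normedZmodType F) (v : V) : rnorm (- v) = rnorm v.
Proof. by rewrite /rnorm normrN. Qed.

Lemma rnormD (V : normedZmodType F) (u v : V) :
  rnorm (u + v) <= rnorm u + rnorm v.
Proof. by rewrite -sembed_le sembedD !rnormE ler_normD. Qed.

Lemma rnormM (a b : F) : rnorm (a * b) = rnorm a * rnorm b.
Proof. by apply: (can_inj sembedK); rewrite sembedM !rnormE normrM. Qed.

Lemma rnorm_lt (V : normedZmodType F) (v : V) (r : R) :
  (rnorm v < r) = (`|v| < sembed r).
Proof. by rewrite -sembed_lt rnormE. Qed.

Lemma ball_rnorm (V : normedModType F) (u v : V) (r : R) :
  ball u (sembed r) v <-> rnorm (u - v) < r.
Proof. by rewrite -ball_normE/= rnorm_lt. Qed.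

Definition scalar_rat : rat * rat -> F :=
  match k return rat * rat -> scalarF R k with
  | RealScalar => fun q => ratr q.1
  | ComplexScalar => fun q => (ratr q.1 +i* ratr q.2)%C end.

Let rat_approx (z : R) (e : R) : 0 < e -> exists q, `|z - ratr q| < e.
Proof.
move=> e0; have : z - e < z + e by rewrite ltrD2l gt0_cp.
by move=> /rat_in_itvoo[q]; rewrite in_itv/= -ltr_distl distrC; exists q.
Qed.

Lemma scalar_rat_dense (z : F) (e : R) : 0 < e ->
  exists q, rnorm (z - scalar_rat q) < e.
Proof.
rewrite /rnorm /sre /scalar_rat; case: k z => [|] z e0 /=.
  by have [q qP] := rat_approx z e0; exists (q, q).
case: z => a b.
have e20 : 0 < e / 2 by rewrite divr_gt0.
have [p pP] := rat_approx a e20; have [q qP] := rat_approx b e20.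
exists (p, q) => /=.
set u := a - _ in pP *; set v := b - _ in qP *.
rewrite -(@ltr_pXn2r _ 2)// ?nnegrE ?sqrtr_ge0 ?(ltW e0)//.
rewrite sqr_sqrtr ?addr_ge0 ?sqr_ge0//.
have uP : u ^+ 2 < (e / 2) ^+ 2.
  by rewrite -(real_normK (num_real u)) ltr_pXn2r// ?nnegrE// ltW.
have vP : v ^+ 2 < (e / 2) ^+ 2.
  by rewrite -(real_normK (num_real v)) ltr_pXn2r// ?nnegrE// ltW.
rewrite (lt_le_trans (ltrD uP vP))//.
rewrite [in leRHS](splitr e) sqrrD lerD2r lerDl.
by rewrite mulrn_wge0// mulr_ge0// ltW.
Qed.

End scalarF.

Section borel.
Context d (X : measurableType d) (R : realType) (k : scalar_kind).
Local Notation F := (scalarF R k).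

(* The Borel sigma-algebra of [V] is generated by its norm-open sets. *)
Definition borel_measurable (V : normedModType F) (f : X -> V) : Prop :=
  measurable_fun [set: X] (f : X -> g_sigma_algebraType (@open V)).

Lemma borel_measurableP (V : normedModType F) (f : X -> V) :
  borel_measurable f <-> forall U, open U -> measurable (f @^-1` U).
Proof.
split=> [mf U oU|mf].
  rewrite -[_ @^-1` _]setTI; apply: mf => //; exact: sub_sigma_algebra.
apply: (@measurability _ _ X (g_sigma_algebraType (@open V))
  _ _ (@open V)) => //.
by move=> _ [U oU <-]; rewrite setTI; exact: mf.
Qed.

Lemma borel_measurable_cst (V : normedModType F) (v : V) :
  borel_measurable (cst v).
Proof. exact: measurable_cst. Qed.

Lemma borel_measurable_comp (V W : normedModType F) (f : X -> V) (g : V -> W) :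
  continuous g -> borel_measurable f -> borel_measurable (g \o f).
Proof.
move=> /continuousP cg /borel_measurableP mf; apply/borel_measurableP => U oU.
by rewrite comp_preimage; exact/mf/cg.
Qed.

Lemma open_rball (V : normedModType F) (c : V) (r : R) :
  open [set v | rnorm (c - v) < r].
Proof.
rewrite (_ : [set v | _] = ball c (sembed k r)); last first.
  by apply/seteqP; split => v /ball_rnorm.
exact: ball_open.
Qed.

Lemma borel_measurable_real (V : normedModType F) (f : X -> V) (g : V -> R) :
  (forall r, open [set v | r < g v]) -> borel_measurable f ->
  measurable_fun [set: X] (g \o f).
Proof.
move=> og /borel_measurableP mf.
apply: (measurability _ (RGenOInfty.measurableE R)) => _ [_ [r ->] <-].
rewrite setTI; have := mf _ (og r); congr (measurable _).
by apply/seteqP; split => x; rewrite /= in_itv/= andbT.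
Qed.

Lemma open_rnorm_gt (V : normedModType F) (r : R) :
  open [set v : V | r < rnorm v].
Proof.
rewrite (_ : [set v | _] = \bigcup_(w in [set w | r < rnorm w])
    [set v | rnorm (w - v) < rnorm w - r]); last first.
  apply/seteqP; split => [v /= rv|v [w /= rw wv]].
    by exists v => //=; rewrite subrr rnorm0 subr_gt0.
  rewrite -(ltrD2l (rnorm (w - v))) (lt_le_trans _ (rnormD _ _))// subrK.
  by rewrite -ltrBrDr.
by apply: bigcup_open => w _; exact: open_rball.
Qed.

Lemma measurable_rnorm (V : normedModType F) (f : X -> V) :
  borel_measurable f -> measurable_fun [set: X] (fun x => rnorm (f x)).
Proof. exact/borel_measurable_real/open_rnorm_gt. Qed.

Lemma rnorm_sre (a b : F) : `|sre a - sre b| <= rnorm (a - b).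
Proof.
rewrite /sre /rnorm; case: k a b => //= -[a1 a2] -[b1 b2].
by rewrite -lecR (le_trans _ (normc_ge_Re _)).
Qed.

Lemma open_sre_gt (r : R) : open [set a : F | r < sre a].
Proof.
rewrite (_ : [set v | _] = \bigcup_(w in [set w : F | r < sre w])
    [set v | rnorm (w - v) < sre w - r]); last first.
  apply/seteqP; split => [v /= rv|v [w /= rw wv]].
    by exists v => //=; rewrite subrr rnorm0 subr_gt0.
  have := le_lt_trans (rnorm_sre w v) wv.
  by rewrite ltr_norml => /andP[_]; rewrite ltrD2l ltrN2.
by apply: bigcup_open => w _; exact: open_rball.
Qed.

Lemma measurable_sre (f : X -> F) :
  borel_measurable f -> measurable_fun [set: X] (fun x => sre (f x)).
Proof. exact/borel_measurable_real/open_sre_gt. Qed.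

Lemma borel_measurableZ (a : F) (f : X -> F) :
  borel_measurable f -> borel_measurable (fun x => a * f x).
Proof.
by apply: (@borel_measurable_comp _ _ _ ( *%R a)); exact: mulrl_continuous.
Qed.

Lemma borel_measurableD (f g : X -> F) :
  borel_measurable f -> borel_measurable g ->
  borel_measurable (fun x => f x + g x).
Proof.
move=> /borel_measurableP mf /borel_measurableP mg.
apply/borel_measurableP => U oU.
pose B (t : (rat * rat) * nat) : set F :=
  [set a | rnorm (scalar_rat R k t.1 - a) < t.2.+1%:R^-1].
pose good (t u : (rat * rat) * nat) :=
  forall a b, B t a -> B u b -> U (a + b).
have -> : (fun x => f x + g x) @^-1` U =
   \bigcup_(p : ((rat * rat) * nat) * ((rat * rat) * nat))
   (if `[< good p.1 p.2 >] then f @^-1` B p.1 `&` g @^-1` B p.2 else set0).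
  apply/seteqP; split => [x /= Ux|x [[t u] _ /=]]; last first.
    by case: asboolP => // tu [ft gu]; exact: tu.
  have /nbhs_ballP[e /= e0 eU] : nbhs (f x + g x) U by exact: open_nbhs_nbhs.
  have r0 : 0 < sre e / 4.
    by rewrite divr_gt0// -(sembed_lt k) sembed0 sreK// ltW.
  have [n nr] : exists n, n.+1%:R^-1 < sre e / 4.
    by have [n _ /(_ n (leqnn n))] := near_infty_natSinv_lt (PosNum r0);
      exists n.
  have n0 : 0 < n.+1%:R^-1 :> R by rewrite invr_gt0.
  have [p pf] := scalar_rat_dense (f x) n0.
  have [q qg] := scalar_rat_dense (g x) n0.
  exists ((p, n), (q, n)) => //=.
  rewrite asboolT; last first.
    move=> a b; rewrite /B/= => pa qb; apply: eU.
    rewrite -[e]sreK ?(ltW e0)//; apply/ball_rnorm.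
    rewrite opprD addrACA (le_lt_trans (rnormD _ _))//.
    have -> : sre e = sre e / 4 + sre e / 4 + (sre e / 4 + sre e / 4).
      by rewrite -!mulr2n -mulrnA -[RHS]mulr_natr divfK ?pnatr_eq0.
    have tri (u v w : F) : rnorm (u - w) <= rnorm (u - v) + rnorm (v - w).
      by rewrite -{1}(subrK v u) -addrA rnormD.
    apply: ltrD; [apply: le_lt_trans (tri _ (scalar_rat R k p) _) _|
      apply: le_lt_trans (tri _ (scalar_rat R k q) _) _];
      by apply: ltrD; apply: lt_trans nr.
  by rewrite /B/=; split => /=; rewrite -rnormN opprB.
apply: countable_bigcupT_measurable => // -[t u] /=.
case: ifPn => _; last exact: measurable0.
by apply: measurableI; [apply: mf|apply: mg]; exact: open_rball.
Qed.

End borel.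

Section L2.
Context d (X : measurableType d) (R : realType) (k : scalar_kind).
Variable mu : {measure set X -> \bar R}.
Local Notation F := (scalarF R k).

Definition sqr_integral (f : X -> F) : \bar R :=
  (\int[mu]_x (rnorm (f x) ^+ 2)%:E)%E.

Definition L2pred : {pred X -> F} :=
  [pred f : X -> F | `[< borel_measurable f /\ (sqr_integral f < +oo)%E >]].

Lemma L2predP (f : X -> F) :
  reflect (borel_measurable f /\ (sqr_integral f < +oo)%E) (f \in L2pred).
Proof. exact: asboolP. Qed.

Lemma L2pred_submod_closed : submod_closed L2pred.
Proof.
split.
  apply/L2predP; split; first exact: borel_measurable_cst.
  rewrite /sqr_integral (eq_integral (cst 0%E)) ?integral0 ?ltry// => x _.
  by rewrite rnorm0 expr0n.
move=> a f g /L2predP[mf f2] /L2predP[mg g2]; apply/L2predP.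
have mfg : borel_measurable (a *: f + g).
  exact: (borel_measurableD (borel_measurableZ a mf) mg).
split => //.
have mf2 : measurable_fun setT (fun x => (rnorm (f x) ^+ 2)%:E).
  by apply/measurable_EFinP; apply: measurable_funX; exact: measurable_rnorm.
have mg2 : measurable_fun setT (fun x => (rnorm (g x) ^+ 2)%:E).
  by apply/measurable_EFinP; apply: measurable_funX; exact: measurable_rnorm.
pose c := 2 * rnorm a ^+ 2.
have c0 : 0 <= c by rewrite mulr_ge0// sqr_ge0.
apply: (@le_lt_trans _ _ (\int[mu]_x
    (c%:E * (rnorm (f x) ^+ 2)%:E + 2%:E * (rnorm (g x) ^+ 2)%:E))%E).
  apply: ge0_le_integral => //.
  - by move=> x _; rewrite lee_fin sqr_ge0.
  - by apply/measurable_EFinP; apply: measurable_funX; exact: measurable_rnorm.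
  - by apply: emeasurable_funD; exact: measurable_funeM.
  - move=> x _; rewrite -!EFinM -EFinD lee_fin.
    have h : rnorm ((a *: f + g) x) <= rnorm a * rnorm (f x) + rnorm (g x).
      by rewrite -rnormM; exact: rnormD.
    have := rnorm_ge0 ((a *: f + g) x).
    rewrite /c.
    move: (rnorm _) (rnorm a) (rnorm (f x)) (rnorm (g x)) h => u v w z.
    move=> h u0; have sq : u ^+ 2 <= (v * w + z) ^+ 2.
      by rewrite lerXn2r ?nnegrE// (le_trans u0 h).
    apply: (le_trans sq); rewrite -subr_ge0.
    have -> : 2 * v ^+ 2 * w ^+ 2 + 2 * z ^+ 2 - (v * w + z) ^+ 2 =
      (v * w - z) ^+ 2 by ring.
    exact: sqr_ge0.
have ge0 (h : X -> F) b x : 0 <= b -> (0 <= b%:E * (rnorm (h x) ^+ 2)%:E)%E.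
  by move=> b0; rewrite -EFinM lee_fin mulr_ge0// sqr_ge0.
rewrite ge0_integralD//=; [|by move=> x _; exact: ge0|exact: measurable_funeM
  |by move=> x _; exact: ge0|exact: measurable_funeM].
rewrite !ge0_integralZl//=; try by move=> x _; rewrite lee_fin sqr_ge0.
by rewrite lte_add_pinfty// lte_mul_pinfty.
Qed.

HB.instance Definition _ :=
  GRing.isSubmodClosed.Build F (X -> F) L2pred L2pred_submod_closed.

Record L2fun := MkL2fun { L2val :> X -> F ; L2valP : L2val \in L2pred }.

HB.instance Definition _ := [isSub for L2val].
HB.instance Definition _ := [Choice of L2fun by <:].
HB.instance Definition _ := [SubChoice_isSubLmodule of L2fun by <:].

(* [L2] identifies the square-integrable functions that agree [mu]-a.e.; see
   [L2classP]. *)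
Definition L2null : {pred L2fun} :=
  [pred f : L2fun | `[< {ae mu, forall x, f x = 0} >]].

Lemma L2nullP (f : L2fun) :
  reflect ({ae mu, forall x, f x = 0}) (f \in L2null).
Proof. exact: asboolP. Qed.

Lemma L2null_submod_closed : submod_closed L2null.
Proof.
split; first by apply/L2nullP; exact: nearW.
move=> a f g /L2nullP f0 /L2nullP g0; apply/L2nullP.
by apply: filterS2 f0 g0 => x fx gx; rewrite /= !fctE fx gx scaler0 addr0.
Qed.

HB.instance Definition _ :=
  GRing.isSubmodClosed.Build F L2fun L2null L2null_submod_closed.

Local Open Scope quotient_scope.

Definition L2 := Quotient.quot L2null.

HB.instance Definition _ := GRing.Zmodule.on L2.
HB.instance Definition _ : EqQuotient L2fun (Quotient.equiv L2null) L2 :=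
  EqQuotient.on L2.

Definition L2class (f : L2fun) : L2 := \pi f.

Lemma L2classP (f g : L2fun) :
  L2class f = L2class g <-> {ae mu, forall x, f x = g x}.
Proof.
transitivity (f - g \in L2null).
  by rewrite Quotient.idealrBE; split => [fg|/eqP]; first exact/eqP.
split=> [/L2nullP|] fg; [|apply/L2nullP].
  by apply: filterS fg => x /= /eqP; rewrite subr_eq0 => /eqP.
by apply: filterS fg => x fgx; apply/eqP; rewrite /= subr_eq0; apply/eqP.
Qed.

Lemma L2classK (u : L2) : L2class (repr u) = u. Proof. exact: reprK. Qed.

Lemma L2classD (f g : L2fun) : L2class (f + g) = L2class f + L2class g.
Proof. exact: (Quotient.pi_add L2null). Qed.

Definition L2scale (a : F) (u : L2) : L2 := L2class (a *: repr u).

Lemma L2scaleE (a : F) (f : L2fun) : L2scale a (L2class f) = L2class (a *: f).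
Proof.
apply/L2classP; have /L2classP := L2classK (L2class f).
by apply: filterS => x /= fx; rewrite !fctE fx.
Qed.

Lemma L2scaleA (a b : F) (u : L2) : L2scale a (L2scale b u) = L2scale (a * b) u.
Proof. by rewrite -(L2classK u) !L2scaleE scalerA. Qed.

Lemma L2scale1 : left_id 1 L2scale.
Proof. by move=> u; rewrite -(L2classK u) L2scaleE scale1r. Qed.

Lemma L2scaleDr : right_distributive L2scale +%R.
Proof.
move=> a u v; rewrite -(L2classK u) -(L2classK v).
by rewrite -L2classD !L2scaleE scalerDr L2classD.
Qed.

Lemma L2scaleDl (u : L2) : {morph L2scale^~ u : a b / a + b}.
Proof.
by move=> a b; rewrite -(L2classK u) !L2scaleE scalerDl L2classD.
Qed.

HB.instance Definition _ := GRing.Zmodule_isLmodule.Build F L2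
  L2scaleA L2scale1 L2scaleDr L2scaleDl.

Definition L2norm (u : L2) : R := Num.sqrt (fine (sqr_integral (repr u))).

Lemma L2normE (f : L2fun) :
  L2norm (L2class f) = Num.sqrt (fine (sqr_integral f)).
Proof.
have m (g : L2fun) : measurable_fun setT (fun x => (rnorm (g x) ^+ 2)%:E).
  have /L2predP[mg _] := L2valP g.
  by apply/measurable_EFinP; apply: measurable_funX; exact: measurable_rnorm.
rewrite /L2norm /sqr_integral; congr (Num.sqrt (fine _)).
apply: ge0_ae_eq_integral => //; try by move=> x _; rewrite lee_fin sqr_ge0.
have /L2classP := L2classK (L2class f).
by apply: filterS => x fx _; rewrite fx.
Qed.

End L2.

Section density.
Context d (X : measurableType d) (R : realType).
Variables (mu : {measure set X -> \bar R}) (g : X -> R).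
Hypotheses (mg : measurable_fun [set: X] g) (g0 : forall x, 0 <= g x).

(* The measure [nu] with [d nu = g d mu]; the measure instance needs the
   measurability and nonnegativity of [g]. *)
Definition density of measurable_fun [set: X] g & (forall x, 0 <= g x) :=
  fun A : set X => (\int[mu]_(x in A) (g x)%:E)%E.

Local Notation nu := (density mg g0).

Let density0 : nu set0 = 0%E.
Proof. by rewrite /density integral_set0. Qed.

Let density_ge0 A : (0 <= nu A)%E.
Proof. by apply: integral_ge0 => x _; rewrite lee_fin. Qed.

Let density_sigma_additive : semi_sigma_additive nu.
Proof.
move=> A mA tA mUA; rewrite /density ge0_integral_bigcup//=.
- by apply: is_cvg_ereal_nneg_natsum => n _; exact: density_ge0.
- by apply/measurable_EFinP; exact: measurable_funTS.
- by move=> x _; rewrite lee_fin.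
Qed.

HB.instance Definition _ := isMeasure.Build _ _ _ nu
  density0 density_ge0 density_sigma_additive.

End density.

Definition separable_set (T : topologicalType) (A : set T) : Prop :=
  exists S : set T, [/\ countable S, S `<=` A & A `<=` closure S].

Section bochner.
Context d (X : measurableType d) (R : realType) (k : scalar_kind).
Variable mu : {measure set X -> \bar R}.
Variable V : normedModType (scalarF R k).
Implicit Types f s : X -> V.

Definition strongly_measurable f : Prop :=
  borel_measurable f /\ separable_set (range f).

Definition bochner_integrable f : Prop :=
  strongly_measurable f /\ (\int[mu]_x (rnorm (f x))%:E < +oo)%E.

Definition bochner_simple s : Prop :=
  [/\ borel_measurable s, finite_set (range s)
    & (mu [set x | s x != 0%R] < +oo)%E].

Definition simple_integral s : V :=
  \sum_(v \in range s) sembed k (fine (mu (s @^-1` [set v]))) *: v.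

(* [I] is the limit of the integrals of simple functions converging to [f] in
   mean. *)
Definition is_bochner_integral f (I : V) : Prop :=
  exists s_ : nat -> X -> V, [/\ forall n, bochner_simple (s_ n),
    (\int[mu]_x (rnorm (f x - s_ n x))%:E)%E @[n --> \oo] --> 0%E
    & simple_integral (s_ n) @[n --> \oo] --> I].

(* Equal to [0] if no [I] satisfies [is_bochner_integral f I]. *)
Definition bochner_integral f : V := xget 0 [set I | is_bochner_integral f I].

End bochner.

(* A Hilbert space of functions on [X] is a complete normed space whose norm
   comes from an inner product (linear in its first argument) together with a
   linear injection [rk_eval] into [X -> F], with the pointwise operations:
   [rk_eval f p] is the value [f(p)]. [rk_section p] is the element [K_p] of the
   space, whose underlying function is [K(., p)]. *)
Record rkhs (R : realType) (k : scalar_kind) (X : Type) := Rkhs {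
  rk_space :> completeNormedModType (scalarF R k) ;
  rk_inner : {dot rk_space for @sconj R k} ;
  rk_normE : forall f : rk_space, `|f| ^+ 2 = rk_inner f f ;
  rk_eval : {linear rk_space -> (X -> scalarF R k)} ;
  rk_eval_inj : injective rk_eval ;
  rk_kernel : X -> X -> scalarF R k ;
  rk_section : X -> rk_space ;
  rk_sectionE : forall p, rk_eval (rk_section p) = rk_kernel ^~ p ;
  rk_reproducing : forall f p, rk_eval f p = rk_inner f (rk_section p) }.

Section kernel_measure.
Context d (X : measurableType d) (R : realType) (k : scalar_kind).
Variables (P : {measure set X -> \bar R}) (H : rkhs R k X).

Definition kernel_measurable : Prop :=
  borel_measurable (fun xy : X * X => rk_kernel H xy.1 xy.2).

Lemma rk_diagE (x : X) : rk_kernel H x x = `|rk_section H x| ^+ 2.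
Proof.
by rewrite rk_normE -rk_reproducing rk_sectionE.
Qed.

Lemma rk_diag_ge0 (x : X) : 0 <= sre (rk_kernel H x x).
Proof. by apply: sre_ge0; rewrite rk_diagE exprn_ge0. Qed.

Lemma measurable_rk_diag : kernel_measurable ->
  measurable_fun [set: X] (fun x => sre (rk_kernel H x x)).
Proof.
move=> /borel_measurableP mK; apply: measurable_sre.
apply/borel_measurableP => U oU.
have mdiag : measurable_fun [set: X] (fun x : X => (x, x)).
  exact: measurable_fun_pair.
by have := mdiag measurableT _ (mK _ oU); rewrite setTI.
Qed.

(* By [rk_diagE] the scalar [K(x, x)] is a nonnegative real, so [sre] only
   retypes it. *)
Definition kernel_measure (mK : kernel_measurable) :=
  density P (measurable_rk_diag mK) rk_diag_ge0.

End kernel_measure.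

(* Main.v *)
(* The kernel identities |K_x|^2 = K(x,x) and <K_x, K_p> = K(p,x) express the
   distance between two values of x |-> l(x) K_x through [l] and the kernel; since
   the range is separable, this makes the map strongly measurable.  Its norm has
   square |l(x)|^2 K(x,x), so the square of the norm has P-integral
   |l|^2_{L^2(P_K)}, and integrability of the norm follows from a <= 1 + a^2 as P
   has mass 1.

   For simple functions s, Re <\int s, h> = \int Re <s, h>.  Taking
   h = \int s - \int t gives |\int s - \int t| <= \int |s - t|, so the integrals of
   simple functions converging in mean form a Cauchy sequence.  In the limit every
   Bochner integral I of f satisfies Re <I, h> = \int Re <f, h> for all h, which
   reduces linearity, invariance under changes on null sets and |I| <= \int |f| to
   real integrals.  Nonexpansiveness is then Jensen's inequality
   (\int |f|)^2 <= \int |f|^2. *)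
From HB Require Import structures.
Require Import Defs.
From mathcomp Require Import all_boot all_order all_algebra.
From mathcomp Require Import finmap sesquilinear complex.
From mathcomp Require Import all_classical all_reals all_analysis.
From mathcomp Require Import measurable_realfun ring lra.

Set Implicit Arguments.
Unset Strict Implicit.
Unset Printing Implicit Defensive.

Import Order.TTheory GRing.Theory Num.Theory.
Import numFieldNormedType.Exports.

Local Open Scope classical_set_scope.
Local Open Scope ring_scope.

(** * Scalars and norms: real parts, and topology expressed through the real-valued norm *)

Section scalars.
Context (R : realType) (k : scalar_kind).
Local Notation F := (scalarF R k).

Lemma sreD (a b : F) : sre (a + b) = sre a + sre b.
Proof. by rewrite /sre; case: k a b => // -[a1 a2] [b1 b2]. Qed.

Lemma sreN (a : F) : sre (- a) = - sre a.
Proof. by rewrite /sre; case: k a => // -[]. Qed.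

Lemma sreM_embed (r : R) (a : F) : sre (sembed k r * a) = r * sre a.
Proof.
by rewrite /sre /sembed; case: k a => // -[a1 a2] /=; rewrite mul0r subr0.
Qed.

Lemma sre_conj (a : F) : sre (sconj a) = sre a.
Proof. by rewrite /sre /sconj; case: k a => // -[]. Qed.

Lemma sconjK : involutive (@sconj R k).
Proof. by rewrite /sconj; case: k => // -[a b] /=; rewrite opprK. Qed.

Lemma rnormZ (V : normedModType F) (a : F) (v : V) :
  rnorm (a *: v) = rnorm a * rnorm v.
Proof. by apply: (can_inj (@sembedK R k)); rewrite sembedM !rnormE normrZ. Qed.

Lemma rnormZ_embed (V : normedModType F) (r : R) (v : V) :
  rnorm (sembed k r *: v) = `|r| * rnorm v.
Proof.
rewrite rnormZ; congr (_ * _); rewrite /rnorm /sembed /sre; case: k => //.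
by rewrite normc_def /= expr0n addr0 sqrtr_sqr.
Qed.

Lemma rnorm_distC (V : normedModType F) (u v : V) : rnorm (u - v) = rnorm (v - u).
Proof. by rewrite -rnormN opprB. Qed.

Lemma rnorm_triangle (V : normedModType F) (w u v : V) :
  rnorm (u - v) <= rnorm (u - w) + rnorm (w - v).
Proof. by rewrite -[X in rnorm X <= _](subrKA w) rnormD. Qed.

Lemma rnorm_eq0 (V : normedModType F) (v : V) : (rnorm v == 0) = (v == 0).
Proof.
by rewrite -(inj_eq (can_inj (@sembedK R k))) rnormE sembed0 normr_eq0.
Qed.

Lemma cvg_rnormP (V : normedModType F) (u : nat -> V) (l : V) :
  u @ \oo --> l <->
  forall e : R, 0 < e -> \forall n \near \oo, rnorm (l - u n) < e.
Proof.
split=> [/cvgrPdist_lt ul e e0|ul].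
  have /ul : 0 < sembed k e by rewrite -(sembed0 R k) sembed_lt.
  by apply: filterS => n; rewrite rnorm_lt.
apply/cvgrPdist_lt => e e0.
have e'0 : 0 < sre e by rewrite -(sembed_lt k) sembed0 sreK// ltW.
apply: filterS (ul _ e'0) => n; rewrite rnorm_lt sreK//; exact: ltW.
Qed.

Lemma closure_rnormP (V : normedModType F) (S : set V) (v : V) :
  closure S v <-> forall e : R, 0 < e -> exists2 u, S u & rnorm (v - u) < e.
Proof.
split=> [Sv e e0|Sv B /nbhs_ballP[e /= e0 eB]].
  have /Sv[u [Su /ball_rnorm vu]] : nbhs v (ball v (sembed k e)).
    by apply: nbhsx_ballx; rewrite -(sembed0 R k) sembed_lt.
  by exists u.
have e'0 : 0 < sre e by rewrite -(sembed_lt k) sembed0 sreK// ltW.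
have [u Su vu] := Sv _ e'0; exists u; split => //; apply: eB.
by rewrite -[e]sreK ?(ltW e0)//; apply/ball_rnorm.
Qed.

Lemma cauchy_rnorm_cvg (V : completeNormedModType F) (u : nat -> V) :
  (forall e : R, 0 < e -> exists N, forall m n, (N <= m)%N -> (N <= n)%N ->
     rnorm (u m - u n) < e) ->
  exists l : V, u @ \oo --> l.
Proof.
move=> cu; suff /cauchy_cvg/cvg_ex : cauchy (u @ \oo) by [].
apply: cauchy_exP => e e0.
have e'0 : 0 < sre e by rewrite -(sembed_lt k) sembed0 sreK// ltW.
have [N Nu] := cu _ e'0; exists (u N), N => // n /= Nn.
by rewrite -[e]sreK ?(ltW e0)//; apply/ball_rnorm/Nu.
Qed.

(** Supplies the openness hypothesis of [borel_measurable_real], for [rdot^~ w] and for the distance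
    to a fixed point. *)
Lemma lipschitz_open_gt (V : normedModType F) (g : V -> R) (c : R) :
  (forall u v, `|g u - g v| <= c * rnorm (u - v)) ->
  forall r, open [set v | r < g v].
Proof.
move=> gl r; rewrite openE => v /= rv; rewrite /interior.
(* [|c| + 1] is again a Lipschitz constant and is safe to divide by, whatever the sign of [c]. *)
have c0 : 0 < `|c| + 1 by rewrite ltr_wpDl.
pose e := (g v - r) / (`|c| + 1).
have e0 : 0 < e by rewrite divr_gt0// subr_gt0.
apply/nbhs_ballP; exists (sembed k e); first by rewrite /= -(sembed0 R k) sembed_lt.
move=> w /ball_rnorm vw /=.
have : `|g v - g w| < g v - r.
  apply: le_lt_trans (gl v w) _; rewrite -(divfK (lt0r_neq0 c0) (g v - r)) mulrC.
  apply: le_lt_trans (_ : rnorm (v - w) * (`|c| + 1) < _); last first.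
    by rewrite ltr_pM2r.
  by rewrite ler_wpM2l ?rnorm_ge0// (le_trans (ler_norm _))// lerDl.
by rewrite ltr_norml => /andP[_]; rewrite ltrD2l ltrN2.
Qed.

End scalars.

(** * The real part of the inner product, and Cauchy-Schwarz *)

Section real_inner_product.
Context (R : realType) (k : scalar_kind) (Y : Type) (H : rkhs R k Y).
Implicit Types u v w : H.

(** Over both scalar fields this is a real symmetric bilinear form with the same norm, so pairings
    can be integrated as real functions. *)
Definition rdot u v : R := sre (rk_inner H u v).

Lemma rdotC u v : rdot u v = rdot v u.
Proof.
rewrite /rdot [in LHS](@hermitian_subproof _ _ _ _ (rk_inner H)).
by rewrite expr0 mul1r sre_conj.
Qed.

Lemma rdotDl u v w : rdot (u + v) w = rdot u w + rdot v w.
Proof. by rewrite /rdot linearDl sreD. Qed.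

Lemma rdotBl u v w : rdot (u - v) w = rdot u w - rdot v w.
Proof. by rewrite /rdot linearBl sreD sreN. Qed.

Lemma rdotBr u v w : rdot u (v - w) = rdot u v - rdot u w.
Proof. by rewrite !(rdotC u) rdotBl. Qed.

Lemma rdot0l v : rdot 0 v = 0.
Proof. by rewrite -(subrr v) rdotBl subrr. Qed.

Lemma rdotZl (r : R) u v : rdot (sembed k r *: u) v = r * rdot u v.
Proof. by rewrite /rdot linearZl_LR sreM_embed. Qed.

(** Moving the scalar into the test vector recovers linearity over the full field from a form that
    is only real bilinear. *)
Lemma rdotZlr (a : scalarF R k) u v : rdot (a *: u) v = rdot u (sconj a *: v).
Proof.
by rewrite /rdot linearZl_LR linearZr_LR/= sconjK.
Qed.

Lemma rdotvv u : rdot u u = rnorm u ^+ 2.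
Proof.
apply: (can_inj (@sembedK R k)); rewrite expr2 sembedM rnormE -expr2 rk_normE.
by rewrite /rdot sreK// -rk_normE exprn_ge0.
Qed.

Lemma rnormB_sqr u v :
  rnorm (u - v) ^+ 2 = rnorm u ^+ 2 - 2 * rdot u v + rnorm v ^+ 2.
Proof.
rewrite -!rdotvv rdotBl !rdotBr (rdotC v u); ring.
Qed.

(** With [a = rnorm u], [b = rnorm v] and [t = rdot u v], the squared norm of [b u - a v] is
    [2ab(ab - t)]; it is nonnegative, and [2ab] can be cancelled once both vectors are nonzero. *)
Lemma ler_rdot u v : rdot u v <= rnorm u * rnorm v.
Proof.
have [->|v0] := eqVneq v 0.
  by rewrite rdotC rdot0l mulr_ge0 ?rnorm_ge0.
have [->|u0] := eqVneq u 0.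
  by rewrite rdot0l mulr_ge0 ?rnorm_ge0.
have a0 : 0 < rnorm u by rewrite lt_neqAle eq_sym rnorm_eq0 u0 rnorm_ge0.
have b0 : 0 < rnorm v by rewrite lt_neqAle eq_sym rnorm_eq0 v0 rnorm_ge0.
have := sqr_ge0 (rnorm (sembed k (rnorm v) *: u - sembed k (rnorm u) *: v)).
rewrite rnormB_sqr !rnormZ_embed rdotZl (rdotC u) rdotZl rdotC.
rewrite !(ger0_norm (rnorm_ge0 _)).
move: (rnorm u) (rnorm v) (rdot u v) a0 b0 => a b t a0 b0 h.
have : 0 <= (2 * (a * b)) * (a * b - t).
  by apply: le_trans h _; rewrite le_eqVlt; apply/orP; left; apply/eqP; ring.
by rewrite pmulr_rge0 ?subr_ge0// !mulr_gt0.
Qed.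

Lemma ler_norm_rdot u v : `|rdot u v| <= rnorm u * rnorm v.
Proof.
rewrite ler_norml ler_rdot andbT lerNl -(rnormN u).
by rewrite -[X in X <= _]add0r -(rdot0l v) -rdotBl sub0r ler_rdot.
Qed.

(** Testing with [w = u - v] suffices. Identities between Bochner integrals are proved below through
    this lemma. *)
Lemma rdot_inj u v : (forall w, rdot u w = rdot v w) -> u = v.
Proof.
move=> uv; apply/eqP; rewrite -subr_eq0 -rnorm_eq0 -sqrf_eq0.
by rewrite -rdotvv rdotBl uv subrr.
Qed.

Lemma open_rdot_gt (w : H) (r : R) : open [set v : H | r < rdot v w].
Proof.
apply: (@lipschitz_open_gt _ _ _ (rdot^~ w) (rnorm w)) => u v.
by rewrite -rdotBl mulrC ler_norm_rdot.
Qed.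

End real_inner_product.

(** * Countable dense sequences and separability of subsets *)

Lemma countable_enum (T : pointedType) (S : set T) :
  countable S -> exists c : nat -> T, S `<=` range c.
Proof.
move=> /countable_injP[f fi]; exists (fun n => xget point [set v | S v /\ f v = n]).
move=> v Sv; exists (f v) => //; case: xgetP => [w -> [Sw]|/(_ v)[]//].
by apply: fi; rewrite inE.
Qed.

Section separability.
Context (R : realType) (k : scalar_kind) (V : normedModType (scalarF R k)).
Implicit Types A B : set V.

Lemma separable_set_enum A : separable_set A ->
  exists c : nat -> V, forall v (e : R), A v -> 0 < e ->
    exists n, rnorm (v - c n) < e.
Proof.
move=> [S [/countable_enum[c Sc] _ AS]]; exists c => v e Av e0.
have /closure_rnormP/(_ _ e0)[u /Sc[n _ <-] vn] := AS _ Av.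
by exists n.
Qed.

(** A dense sequence of [A] may miss [B] altogether, so for each term and each radius [1/(m+1)] a
    point of [B] that close to the term is chosen whenever there is one. *)
Lemma separable_subset A B : B `<=` A -> separable_set A -> separable_set B.
Proof.
move=> BA /separable_set_enum[c cA].
pose near_c (p : nat * nat) := [set v | B v /\ rnorm (v - c p.1) < p.2.+1%:R^-1].
(* Restricting to the nonempty cells keeps the default [0] of [xget] out of the dense set. *)
pose D := [set p | near_c p !=set0].
exists ((fun p => xget 0 (near_c p)) @` D); split.
- exact: card_le_trans (card_image_le _ _) (countableP _).
- by move=> _ [p [v pv] <-]; case: xgetP => [w _ []|/(_ v)].
move=> v Bv; apply/closure_rnormP => e e0.
have e20 : 0 < e / 2 by rewrite divr_gt0.
have [m _ /(_ m (leqnn m)) /= me] := near_infty_natSinv_lt (PosNum e20).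
have m0 : 0 < m.+1%:R^-1 :> R by rewrite invr_gt0.
have [n vn] := cA v _ (BA _ Bv) m0.
have vnm : near_c (n, m) v by [].
exists (xget 0 (near_c (n, m))); first by exists (n, m) => //; exists v.
case: xgetP => [w _ [/= Bw wn]|/(_ v)//].
rewrite (le_lt_trans (rnorm_triangle (c n) _ _))// (splitr e) ltrD//.
  exact: lt_trans me.
by rewrite rnorm_distC; exact: lt_trans me.
Qed.

End separability.

(** * Borel measurability of vector-valued functions *)

Section borel_measurability.
Context d (X : measurableType d) (R : realType) (k : scalar_kind).
Local Notation F := (scalarF R k).

(** By separability, the part of an open set inside the range is covered by countably many balls
    contained in that set and centred at values [f p]; the preimages of these balls are measurable
    by hypothesis. *)
Lemma borel_measurable_dist (V : normedModType F) (f : X -> V) :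
  separable_set (range f) ->
  (forall p, measurable_fun [set: X] (fun x => rnorm (f p - f x))) ->
  borel_measurable f.
Proof.
move=> [S [cS Sf fS]] mf; apply/borel_measurableP => U oU.
have [c Sc] := countable_enum cS.
pose B (t : nat * nat) := [set v | rnorm (c t.1 - v) < t.2.+1%:R^-1].
(* The enumeration [c] may also take a default value outside [S]; requiring [S (c t.1)] guarantees
   that each centre used is a value of [f]. *)
have -> : f @^-1` U = \bigcup_(t : nat * nat)
    (if `[< S (c t.1) /\ B t `<=` U >] then f @^-1` B t else set0).
  apply/seteqP; split => [x /= Ux|x [t _]]; last first.
    by case: asboolP => // -[_ BU] /BU.
  have /nbhs_ballP[e /= e0 eU] : nbhs (f x) U by exact: open_nbhs_nbhs.
  have e20 : 0 < sre e / 2 by rewrite divr_gt0// -(sembed_lt k) sembed0 sreK// ltW.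
  have [m _ /(_ m (leqnn m)) /= me] := near_infty_natSinv_lt (PosNum e20).
  have m0 : 0 < m.+1%:R^-1 :> R by rewrite invr_gt0.
  have /closure_rnormP/(_ _ m0)[u Su xu] : closure S (f x) by exact: fS.
  have [n _ nu] := Sc _ Su; exists (n, m) => //.
  rewrite asboolT; first by rewrite /= /B/= nu rnorm_distC.
  split; rewrite /B/= nu// => v uv; apply: eU.
  rewrite -[e]sreK ?(ltW e0)//; apply/ball_rnorm.
  by rewrite (le_lt_trans (rnorm_triangle u _ _))// (splitr (sre e)) ltrD//;
    exact: lt_trans me.
apply: countable_bigcupT_measurable => // t; case: asboolP => [[/Sf[p _ pc] _]|_].
  rewrite /B -pc; have := mf p measurableT _ (measurable_itv `]-oo, t.2.+1%:R^-1[).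
  by rewrite setTI.
exact: measurable0.
Qed.

Lemma borel_measurableN (f : X -> F) :
  borel_measurable f -> borel_measurable (fun x => - f x).
Proof.
by move=> mf; under eq_fun do rewrite -mulN1r; exact: borel_measurableZ.
Qed.

(** The identity [4ab = (a + b)^2 - (a - b)^2] reduces products to sums and to squaring, which is
    continuous. *)
Lemma borel_measurableM (f g : X -> F) :
  borel_measurable f -> borel_measurable g ->
  borel_measurable (fun x => f x * g x).
Proof.
move=> mf mg.
have sq (h : X -> F) : borel_measurable h -> borel_measurable (fun x => h x * h x).
  apply: (@borel_measurable_comp _ _ _ _ _ _ h (fun a => a * a)) => a.
  have ca : id @ nbhs a --> a by exact: cvg_id.
  exact: (cvgM ca ca).
have -> : (fun x => f x * g x) = (fun x => 4^-1 *
    ((f x + g x) * (f x + g x) + - ((f x + - g x) * (f x + - g x)))).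
  by apply/funext => x; field.
apply/borel_measurableZ/borel_measurableD; [exact/sq/borel_measurableD|].
by apply/borel_measurableN/sq/borel_measurableD => //; exact: borel_measurableN.
Qed.

Lemma measurable_rnorm_dist (V : normedModType F) (f : X -> V) (v : V) :
  borel_measurable f -> measurable_fun [set: X] (fun x => rnorm (f x - v)).
Proof.
apply: (@borel_measurable_real _ _ _ _ _ f (fun u => rnorm (u - v))).
apply: (@lipschitz_open_gt _ _ _ _ 1) => u w; rewrite mul1r.
rewrite ler_distl lerBlDl; apply/andP; split.
  by rewrite (rnorm_distC u w) rnorm_triangle.
by rewrite [leRHS]addrC rnorm_triangle.
Qed.

Lemma measurable_rdot (Y : Type) (H : rkhs R k Y) (f : X -> H) (h : H) :
  borel_measurable f -> measurable_fun [set: X] (fun x => rdot (f x) h).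
Proof.
exact/(@borel_measurable_real _ _ _ _ _ f (fun u => rdot u h))/open_rdot_gt.
Qed.

Lemma measurable_preimage1 (V : normedModType F) (s : X -> V) (v : V) :
  borel_measurable s -> measurable (s @^-1` [set v]).
Proof.
move=> /borel_measurableP ms; rewrite -[_ @^-1` _]setCK preimage_setC.
apply/measurableC/ms/closed_openC.
exact/accessible_closed_set1/hausdorff_accessible/norm_hausdorff.
Qed.

(** In a nonseparable space a difference of Borel functions can fail to be Borel. When [s] has
    finite range, the difference is a translate of [f] on each of finitely many measurable
    pieces. *)
Lemma borel_measurableB_finite (V : normedModType F) (f s : X -> V) :
  borel_measurable f -> borel_measurable s -> finite_set (range s) ->
  borel_measurable (fun x => f x - s x).
Proof.
move=> mf ms fs; apply/borel_measurableP => U oU.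
have -> : (fun x => f x - s x) @^-1` U = \bigcup_(v in range s)
    (s @^-1` [set v] `&` (fun x => f x - v) @^-1` U).
  by apply/seteqP; split => [x Ux|x [_ [y _ <-] [/= <-]]//]; exists (s x) => //; exists x.
apply: fin_bigcup_measurable => // v _; apply: measurableI.
  exact: measurable_preimage1.
move: U oU; apply/borel_measurableP.
apply: (@borel_measurable_comp _ _ _ _ _ _ f (fun u => u - v)) => // u.
by apply: cvgB; [exact: cvg_id|exact: cvg_cst].
Qed.

End borel_measurability.

(** * Strong measurability of the integrand *)

Section kernel_section_measurability.
Context d (X : measurableType d) (R : realType) (k : scalar_kind).
Variable H : rkhs R k X.
Hypotheses (sepH : separable_set [set: H]) (mK : kernel_measurable H).
Variable l : X -> scalarF R k.
Hypothesis ml : borel_measurable l.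
Local Notation f := (fun x => l x *: rk_section H x).

Lemma borel_measurable_kernel_section p :
  borel_measurable (fun x => rk_kernel H p x).
Proof.
move/borel_measurableP : mK => mK'; apply/borel_measurableP => U oU.
have mp : measurable_fun [set: X] (fun x : X => (p, x)).
  exact: measurable_fun_pair.
by have := mp measurableT _ (mK' _ oU); rewrite setTI.
Qed.

Lemma rnorm_rk_section x : rnorm (rk_section H x) ^+ 2 = sre (rk_kernel H x x).
Proof. by rewrite -rdotvv /rdot -rk_reproducing rk_sectionE. Qed.

(* The range of [f] has a countable dense subset consisting of values [f p], and
   the distance from [f p] to [f x] is an explicit function of [l] and of the
   kernel; this avoids showing that every element of [H] is measurable. *)
Lemma strongly_measurable_kernel : strongly_measurable f.
Proof.
have sepf : separable_set (range f) by exact: separable_subset sepH.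
split => //; apply: borel_measurable_dist => // p.
have -> : (fun x => rnorm (f p - f x)) = (fun x => Num.sqrt
   (rnorm (f p) ^+ 2 - 2 * sre (l x * (sconj (l p) * rk_kernel H p x)) +
    rnorm (l x) ^+ 2 * sre (rk_kernel H x x))).
  apply/funext => x; rewrite -[LHS]ger0_norm ?rnorm_ge0// -sqrtr_sqr.
  rewrite rnormB_sqr; congr (Num.sqrt (_ - 2 * _ + _)).
    rewrite rdotC /rdot linearZl_LR linearZr_LR/=.
    by rewrite -rk_reproducing rk_sectionE.
  by rewrite rnormZ exprMn rnorm_rk_section.
apply: (measurableT_comp (continuous_measurable_fun (@sqrt_continuous R))).
apply: measurable_funD.
  apply: measurable_funB => //; apply: measurable_funM => //.
  apply: measurable_sre; apply: borel_measurableM => //.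
  exact/borel_measurableZ/borel_measurable_kernel_section.
apply: measurable_funM; last exact: measurable_rk_diag.
by apply: measurable_funX; exact: measurable_rnorm.
Qed.

End kernel_section_measurability.

(** * Approximation in mean by simple functions *)

Lemma cvge0_near_lt (R : realType) (u : nat -> \bar R) (e : R) :
  u @ \oo --> 0%E -> 0 < e -> \forall n \near \oo, (u n < e%:E)%E.
Proof.
move=> u0 e0; apply: (u0 [set y | (y < e%:E)%E]).
apply: open_nbhs_nbhs; split; last by rewrite /= lte_fin.
exact: open_ereal_lt_ereal.
Qed.

Section simple_approximation.
Context d (X : measurableType d) (R : realType) (k : scalar_kind).
Variables (mu : {finite_measure set X -> \bar R}).
Variables (V : normedModType (scalarF R k)).
Implicit Types f s t : X -> V.

Lemma bochner_simple_finite s :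
  borel_measurable s -> finite_set (range s) -> bochner_simple mu s.
Proof.
move=> ms fs; split => //; rewrite ltey_eq fin_num_measure//.
rewrite (_ : [set x | _] = ~` (s @^-1` [set 0])).
  exact/measurableC/measurable_preimage1.
by apply/seteqP; split => x /= /eqP.
Qed.

Lemma bochner_simpleB s t : bochner_simple mu s -> bochner_simple mu t ->
  bochner_simple mu (fun x => s x - t x).
Proof.
move=> [ms fs _] [mt ft _]; apply: bochner_simple_finite.
  exact: borel_measurableB_finite.
apply: (sub_finite_set (B := (fun p => p.1 - p.2) @` (range s `*` range t))).
  by move=> _ [x _ <-]; exists (s x, t x) => //; split; exists x.
exact/finite_image/finite_setX.
Qed.

Lemma finite_range_bounded s :
  finite_set (range s) -> exists M : R, forall x, rnorm (s x) <= M.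
Proof.
move=> fs; exists (\sum_(v <- fset_set (range s)) rnorm v) => x.
have sx : s x \in fset_set (range s) by rewrite in_fset_set// inE; exists x.
by rewrite (big_rem _ sx)/= lerDl sumr_ge0// => v _; exact: rnorm_ge0.
Qed.

Section approx.
Variables (f : X -> V) (c : nat -> V).

(** Comparing one new candidate at a time, rather than minimising over all of them at once, makes
    finiteness of the range and measurability plain inductions. *)
Fixpoint approx n x : V :=
  if n is m.+1 then
    if rnorm (f x - c m) < rnorm (f x - approx m x) then c m else approx m x
  else 0.

Lemma approx_dist_le n x : rnorm (f x - approx n x) <= rnorm (f x).
Proof.
elim: n => [|n IH] /=; first by rewrite subr0.
by case: ifPn => // /ltW/le_trans; exact.
Qed.

Lemma approx_dist_enum n m x : (m < n)%N ->
  rnorm (f x - approx n x) <= rnorm (f x - c m).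
Proof.
elim: n => // n IH; rewrite ltnS leq_eqVlt => /predU1P[->|/IH {}IH] /=.
  by case: ifPn => //; rewrite -leNgt.
by case: ifPn => // /ltW/le_trans; exact.
Qed.

Lemma finite_range_approx n : finite_set (range (approx n)).
Proof.
elim: n => [|n IH].
  by apply: (sub_finite_set (B := [set 0])) => // _ [x _ <-].
apply: (sub_finite_set (B := range (approx n) `|` [set c n])).
  move=> _ [x _ <-] /=; case: ifPn => _; [by right|by left; exists x].
by rewrite finite_setU.
Qed.

Hypothesis mf : borel_measurable f.

Lemma borel_measurable_approx n : borel_measurable (approx n).
Proof.
elim: n => [|n IH]; first exact: borel_measurable_cst.
apply: measurable_fun_if => //.
- apply: measurable_fun_ltr; first exact: measurable_rnorm_dist.
  apply: measurable_rnorm; apply: borel_measurableB_finite => //.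
  exact: finite_range_approx.
- exact: measurable_funTS.
Qed.

Lemma measurable_approx_dist n :
  measurable_fun [set: X] (fun x => rnorm (f x - approx n x)).
Proof.
apply/measurable_rnorm/borel_measurableB_finite => //.
  exact: borel_measurable_approx.
exact: finite_range_approx.
Qed.

End approx.

Lemma integrable_rnorm f : borel_measurable f ->
  (\int[mu]_x (rnorm (f x))%:E < +oo)%E ->
  mu.-integrable [set: X] (fun x => (rnorm (f x))%:E).
Proof.
move=> mf fi; apply/integrableP; split; first exact/measurable_EFinP/measurable_rnorm.
by under eq_integral do rewrite gee0_abs ?lee_fin ?rnorm_ge0//.
Qed.

Lemma integrable_rnorm_simple s : bochner_simple mu s ->
  mu.-integrable [set: X] (fun x => (rnorm (s x))%:E).
Proof.
move=> [ms /finite_range_bounded[M sM] _].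
apply: (@le_integrable _ _ _ _ _ _ _ (cst M%:E)) => //.
- exact/measurable_EFinP/measurable_rnorm.
- move=> x _ /=; rewrite lee_fin ger0_norm ?rnorm_ge0//.
  exact: le_trans (ler_norm _).
- exact: finite_measure_integrable_cst.
Qed.

(* [approx n x] is the best approximation of [f x] among [0] and the first [n]
   points of a sequence dense in the range of [f]: the error decreases to [0] and
   never exceeds [rnorm (f x)], so dominated convergence applies. *)
Lemma simple_approximation f : bochner_integrable mu f ->
  exists s_ : nat -> X -> V, (forall n, bochner_simple mu (s_ n)) /\
    (\int[mu]_x (rnorm (f x - s_ n x))%:E)%E @[n --> \oo] --> 0%E.
Proof.
move=> [[mf sepf] fi]; have [c cf] := separable_set_enum sepf.
exists (approx f c); split.
  move=> n; apply: bochner_simple_finite; first exact: borel_measurable_approx.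
  exact: finite_range_approx.
have [] := @dominated_convergence _ X R mu setT measurableT
  (fun n x => (rnorm (f x - approx f c n x))%:E) (cst 0%E) (fun x => (rnorm (f x))%:E).
- by move=> n; exact/measurable_EFinP/measurable_approx_dist.
- exact: measurable_cst.
- apply: nearW => x _; apply: cvg_EFin; first exact: nearW.
  apply/cvgrPdist_lt => e e0; have [m fm] := cf (f x) e (imageT f x) e0.
  exists m.+1 => // n /= mn; rewrite sub0r normrN ger0_norm ?rnorm_ge0//.
  exact: le_lt_trans (approx_dist_enum _ _ _ mn) fm.
- exact: integrable_rnorm.
- apply: nearW => x n _; rewrite gee0_abs ?lee_fin ?rnorm_ge0//.
  exact: approx_dist_le.
by move=> _ _; rewrite integral0.
Qed.

End simple_approximation.

(** * The Bochner integral characterised by real pairings *)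

Section weak_integral.
Context d (X : measurableType d) (R : realType) (k : scalar_kind) (Y : Type).
Variables (mu : {finite_measure set X -> \bar R}) (H : rkhs R k Y).
Implicit Types (f s t : X -> H) (h : H).

Lemma integrable_rdot f h : borel_measurable f ->
  mu.-integrable [set: X] (fun x => (rnorm (f x))%:E) ->
  mu.-integrable [set: X] (EFin \o (fun x => rdot (f x) h)).
Proof.
move=> mf fi.
apply: (@le_integrable _ _ _ _ _ _ _ (fun x => (rnorm (f x))%:E * (rnorm h)%:E)%E) => //.
- exact/measurable_EFinP/measurable_rdot.
- move=> x _ /=; rewrite lee_fin.
  by rewrite (le_trans (ler_norm_rdot _ _))// ler_norm.
- exact: integrableZr.
Qed.

Lemma ler_norm_Rintegral_rdot f h : borel_measurable f ->
  mu.-integrable [set: X] (fun x => (rnorm (f x))%:E) ->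
  `|\int[mu]_x rdot (f x) h| <= (\int[mu]_x rnorm (f x)) * rnorm h.
Proof.
move=> mf fi; have fhi := integrable_rdot h mf fi.
apply: le_trans (le_normr_Rintegral _ fhi) _ => //.
rewrite -RintegralZr//; apply: le_Rintegral => //.
- exact: integrable_abse fhi.
- have := integrableZr measurableT (rnorm h) fi; exact: eq_integrable.
- by move=> x _; exact: ler_norm_rdot.
Qed.

(** The paired function is a finite combination of indicators of the level sets of [s], so its
    integral is computed term by term. *)
Lemma rdot_simple_integral s h : bochner_simple mu s ->
  rdot (simple_integral mu s) h = \int[mu]_x rdot (s x) h.
Proof.
move=> [ms fs _]; pose r := fset_set (range s).
have ms1 v : measurable (s @^-1` [set v]) by exact: measurable_preimage1.
have -> : (fun x => rdot (s x) h) =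
    (fun x => \sum_(v <- r) rdot v h * \1_(s @^-1` [set v]) x).
  apply/funext => x.
  have sx : s x \in r by rewrite in_fset_set// inE; exists x.
  rewrite (bigD1_seq (s x)) ?fset_uniq//.
  rewrite [X in _ = _ * X + _]indicE mem_set// mulr1 big1 ?addr0// => v vs.
  rewrite indicE memNset ?mulr0// => /= sv; by rewrite sv eqxx in vs.
rewrite /Rintegral.
under eq_integral do rewrite -sumEFin.
have int1 v : mu.-integrable [set: X] (fun x => (\1_(s @^-1` [set v]) x)%:E).
  exact: integrable_indic.
rewrite integral_sum//; last first.
  by move=> v; under eq_fun do rewrite EFinM; exact: integrableZl.
rewrite /simple_integral fsbig_finite// -/r.
rewrite (big_morph (fun u => rdot u h) (fun u v => rdotDl u v h) (rdot0l h)).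
have e v : (\int[mu]_x (rdot v h * \1_(s @^-1` [set v]) x)%:E)%E =
    (fine (mu (s @^-1` [set v])) * rdot v h)%:E.
  under eq_integral do rewrite EFinM.
  rewrite integralZl// integral_indic// setIT EFinM fineK ?fin_num_measure//.
  by rewrite muleC.
rewrite (eq_bigr _ (fun v _ => e v)).
by rewrite sumEFin /=; apply: eq_bigr => v _; rewrite rdotZl.
Qed.

(** Pairing the difference [h] with itself bounds [rnorm h ^+ 2] by the right-hand side times
    [rnorm h]; one factor then cancels if it is nonzero. *)
Lemma rnorm_simple_integralB s t : bochner_simple mu s -> bochner_simple mu t ->
  rnorm (simple_integral mu s - simple_integral mu t) <=
  \int[mu]_x rnorm (s x - t x).
Proof.
move=> ss st; have [ms fs _] := ss; have [mt ft _] := st; set h := _ - _.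
have [->|h0] := eqVneq (rnorm h) 0.
  by apply: Rintegral_ge0 => x _; exact: rnorm_ge0.
have hp : 0 < rnorm h by rewrite lt_neqAle eq_sym h0 rnorm_ge0.
have sst := bochner_simpleB ss st; have [mst _ _] := sst.
rewrite -(ler_pM2r hp) -expr2 -rdotvv {1}/h rdotBl !rdot_simple_integral//.
rewrite -RintegralB//; try by apply: integrable_rdot => //; exact: integrable_rnorm_simple.
under eq_Rintegral do rewrite -rdotBl.
apply: le_trans (ler_norm _) _; apply: ler_norm_Rintegral_rdot => //.
exact: integrable_rnorm_simple.
Qed.

Section of_function.
Variable f : X -> H.
Hypotheses (mf : borel_measurable f)
  (fi : (\int[mu]_x (rnorm (f x))%:E < +oo)%E).

Lemma integrable_rnormB_simple s : bochner_simple mu s ->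
  mu.-integrable [set: X] (fun x => (rnorm (f x - s x))%:E).
Proof.
move=> ss; have [ms fs _] := ss.
apply: (@le_integrable _ _ _ _ _ _ _
  ((fun x => (rnorm (f x))%:E) \+ (fun x => (rnorm (s x))%:E))%E) => //.
- exact/measurable_EFinP/measurable_rnorm/borel_measurableB_finite.
- move=> x _ /=; rewrite lee_fin ger0_norm ?rnorm_ge0//.
  by rewrite (le_trans _ (ler_norm _))// -(rnormN (s x)) rnormD.
- by apply: integrableD => //; [exact: integrable_rnorm|exact: integrable_rnorm_simple].
Qed.

Lemma near_Rintegral_lt (s_ : nat -> X -> H) (e : R) :
  (forall n, bochner_simple mu (s_ n)) ->
  (\int[mu]_x (rnorm (f x - s_ n x))%:E)%E @[n --> \oo] --> 0%E -> 0 < e ->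
  \forall n \near \oo, \int[mu]_x rnorm (f x - s_ n x) < e.
Proof.
move=> ss s0 e0; apply: filterS (cvge0_near_lt s0 e0) => n.
rewrite -lte_fin /Rintegral fineK//.
apply: integrable_fin_num => //; exact: integrable_rnormB_simple.
Qed.

(** Both sides are compared with the integral of one simple function [s_ n]: one error comes from
    convergence of the integrals, the other from convergence in mean. *)
Lemma rdot_bochner_integral (I h : H) : is_bochner_integral mu f I ->
  rdot I h = \int[mu]_x rdot (f x) h.
Proof.
move=> [s_ [ss s0 sI]].
apply/eqP; rewrite -subr_eq0 -normr_le0; apply/ler_addgt0Pr => e e0; rewrite add0r.
(* The factor [2] shares [e] between the two errors, each of which gets multiplied by [rnorm h]; the
   [+ 1] covers [h = 0]. *)
have q0 : 0 < (rnorm h + 1) * 2 by rewrite mulr_gt0// ltr_wpDl ?rnorm_ge0.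
have e'0 : 0 < e / ((rnorm h + 1) * 2) by rewrite divr_gt0.
have /cvg_rnormP/(_ _ e'0) sI' := sI.
have [n [nI nf]] := filter_ex (filterI sI' (near_Rintegral_lt ss s0 e'0)).
have [ms fs _] := ss n.
rewrite -(subrKA (rdot (simple_integral mu (s_ n)) h)) -rdotBl.
rewrite (le_trans (ler_normD _ _))// distrC rdot_simple_integral//.
rewrite -RintegralB//; first last.
- by apply: integrable_rdot => //; exact: integrable_rnorm_simple.
- by apply: integrable_rdot => //; exact: integrable_rnorm.
under [X in _ + `|X|]eq_Rintegral do rewrite -rdotBl.
have h1 := ler_norm_rdot (I - simple_integral mu (s_ n)) h.
have h2 : `|\int[mu]_x rdot (f x - s_ n x) h| <=
    (\int[mu]_x rnorm (f x - s_ n x)) * rnorm h.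
  apply: ler_norm_Rintegral_rdot; first exact: borel_measurableB_finite.
  exact: integrable_rnormB_simple.
apply: (le_trans (lerD h1 h2)); rewrite -mulrDl.
have -> : e = e / ((rnorm h + 1) * 2) * 2 * (rnorm h + 1).
  by field; rewrite gt_eqF// ltr_wpDl ?rnorm_ge0.
apply: ler_pM; rewrite ?rnorm_ge0 ?lerDl//.
  by rewrite addr_ge0 ?rnorm_ge0// Rintegral_ge0// => x _; rewrite rnorm_ge0.
by rewrite mulr_natr mulr2n lerD// ltW.
Qed.

Lemma rnorm_bochner_integral (I : H) : is_bochner_integral mu f I ->
  rnorm I <= \int[mu]_x rnorm (f x).
Proof.
move=> fI; have [->|I0] := eqVneq (rnorm I) 0.
  by apply: Rintegral_ge0 => x _; exact: rnorm_ge0.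
have Ip : 0 < rnorm I by rewrite lt_neqAle eq_sym I0 rnorm_ge0.
rewrite -(ler_pM2r Ip) -expr2 -rdotvv (rdot_bochner_integral _ fI).
apply: le_trans (ler_norm _) _; apply: ler_norm_Rintegral_rdot => //.
exact: integrable_rnorm.
Qed.

End of_function.

(** Completeness of [H] provides a limit for the integrals of an approximating sequence, so [xget]
    does not fall back on its default. *)
Lemma bochner_integralP f : bochner_integrable mu f ->
  is_bochner_integral mu f (bochner_integral mu f).
Proof.
move=> fi; have [[mf _] f_fin] := fi.
rewrite /bochner_integral; case: xgetP => [//|noI].
have [s_ [ss s0]] := simple_approximation fi.
have [I sI] : exists I : H, simple_integral mu (s_ n) @[n --> \oo] --> I.
  apply: cauchy_rnorm_cvg => e e0.
  have e20 : 0 < e / 2 by rewrite divr_gt0.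
  have [N _ sN] := near_Rintegral_lt mf f_fin ss s0 e20; exists N => m n Nm Nn.
  apply: le_lt_trans (rnorm_simple_integralB (ss m) (ss n)) _.
  have i1 := integrable_rnormB_simple mf f_fin (ss m).
  have i2 := integrable_rnormB_simple mf f_fin (ss n).
  rewrite (splitr e); apply: le_lt_trans (ltrD (sN m Nm) (sN n Nn)).
  rewrite -RintegralD//; apply: le_Rintegral => //; last 1 first.
  - by move=> x _; rewrite (le_trans (rnorm_triangle (f x) _ _))// lerD// rnorm_distC.
  - exact/integrable_rnorm_simple/bochner_simpleB.
  - exact: integrableD i1 i2.
by exfalso; apply: (noI I); exists s_.
Qed.

End weak_integral.

(** * Integration against a measure with a density *)

Section density_integral.
Context d (X : measurableType d) (R : realType).
Variables (mu : {measure set X -> \bar R}) (g : X -> R).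
Hypotheses (mg : measurable_fun [set: X] g) (g0 : forall x, 0 <= g x).
Local Notation nu := (density mu mg g0 : {measure set X -> \bar R}).

Import HBNNSimple.

(** Both integrals split over the level sets of [h]; on each of them [h] is constant and the measure
    [nu] is by definition the integral of [g]. *)
Let density_nnsfun (h : {nnsfun X >-> R}) :
  (\int[nu]_x (h x)%:E = \int[mu]_x (h x * g x)%:E)%E.
Proof.
have mh r : measurable (h @^-1` [set r]) by [].
have mterm r : measurable_fun [set: X]
    (fun x => (h x * g x * \1_(h @^-1` [set r]) x)%:E).
  by apply/measurable_EFinP; do 2 apply: measurable_funM => //.
have -> : (fun x => (h x * g x)%:E) =
    (fun x => \sum_(r \in range h) (h x * g x * \1_(h @^-1` [set r]) x)%:E)%E.
  apply/funext => x; rewrite (fsbigD1 (h x)) ?fsbig1//=; last by exists x.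
  - by rewrite indicE mem_set// mulr1 adde0.
  - move=> r [_ /= rh]; rewrite indicE memNset ?mulr0// => /= hr; exact/rh/esym.
rewrite integralT_nnsfun sintegralE ge0_integral_fsum//; last first.
  by move=> r x _; rewrite lee_fin !mulr_ge0.
apply: eq_fsbigr => r; rewrite inE => -[y _ <-{r}]; set A := _ @^-1` _.
transitivity (\int[mu]_(x in A) ((h y)%:E * (g x)%:E))%E.
  have mA : measurable A by exact: mh.
  rewrite ge0_integralZl//.
  - by apply: measurable_funTS; exact/measurable_EFinP.
  - by move=> x _; rewrite lee_fin.
  - by rewrite lee_fin.
rewrite [LHS]integral_mkcond; apply: eq_integral => x _.
rewrite patchE indicE; case: ifPn => [|xA]; last by rewrite mulr0.
by rewrite inE => /= ->; rewrite mulr1.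
Qed.

(** Monotone convergence along a single increasing sequence of simple functions, applied under [nu]
    and under [mu]. *)
Lemma ge0_integral_density (u : X -> R) :
  measurable_fun [set: X] u -> (forall x, 0 <= u x) ->
  (\int[nu]_x (u x)%:E = \int[mu]_x (u x * g x)%:E)%E.
Proof.
move=> mu_ u0; have mu' : measurable_fun [set: X] (EFin \o u) by exact/measurable_EFinP.
pose h := nnsfun_approx measurableT mu'.
have hu x : (h n x)%:E @[n --> \oo] --> (u x)%:E.
  by apply: (@cvg_nnsfun_approx _ _ _ setT measurableT (EFin \o u)) => // y _; rewrite lee_fin.
have hle x : {homo h^~ x : m n / (m <= n)%N >-> m <= n}.
  by move=> m n mn; exact/lefP/nd_nnsfun_approx.
have <- : limn (fun n => \int[nu]_x (h n x)%:E)%E = (\int[nu]_x (u x)%:E)%E.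
  rewrite -monotone_convergence//.
  - by apply: eq_integral => x _; exact: cvg_lim (hu x).
  - by move=> n; exact/measurable_EFinP.
  - by move=> n x _; rewrite lee_fin.
  - by move=> x _ m n mn; rewrite lee_fin hle.
under eq_fun do rewrite density_nnsfun.
rewrite -monotone_convergence//.
- apply: eq_integral => x _; apply: cvg_lim => //.
  under eq_fun do rewrite EFinM.
  rewrite EFinM; exact: cvgeZr (hu x).
- by move=> n; apply/measurable_EFinP/measurable_funM.
- by move=> n x _; rewrite lee_fin mulr_ge0.
- by move=> x _ m n mn; rewrite lee_fin ler_wpM2r// hle.
Qed.

(** On a [nu]-null set the integral of [g] vanishes, hence [g = 0] there [mu]-almost everywhere. The
    second alternative has to remain, since [nu] does not see the zeros of [g]. *)
Lemma density_ae (p : X -> Prop) :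
  {ae nu, forall x, p x} -> {ae mu, forall x, p x \/ g x = 0}.
Proof.
move=> [A [mA nuA pA]].
have : (\int[mu]_(x in A) `|(g x)%:E| = 0)%E.
  by rewrite -[RHS]nuA; apply: eq_integral => x _; rewrite gee0_abs// lee_fin.
move=> /(ae_eq_integral_abs _ mA) [|N [mN muN gN]].
  by apply: measurable_funTS; exact/measurable_EFinP.
exists N; split => // x /= /not_orP[px gx]; apply: gN => /= gxA; apply: gx.
by have [] := gxA (pA _ px).
Qed.

End density_integral.

(** * The kernel integral operator on square-integrable weights *)

Section kernel_integral.
Context d (X : measurableType d) (R : realType) (k : scalar_kind).
Variables (P : probability X R) (H : rkhs R k X).
Hypotheses (sepH : separable_set [set: H]) (mK : kernel_measurable H).
Local Notation PK := (kernel_measure P mK : {measure set X -> \bar R}).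
Local Notation F := (scalarF R k).
Implicit Types l m : X -> F.

Definition weighted_section l x : H := l x *: rk_section H x.

Lemma rnorm_weighted_section l x :
  rnorm (weighted_section l x) ^+ 2 = rnorm (l x) ^+ 2 * sre (rk_kernel H x x).
Proof. by rewrite rnormZ exprMn rnorm_rk_section. Qed.

(** The density [K(x, x)] is the squared norm of [K_x], so it is absorbed into the integrand and
    only [P] remains. *)
Lemma sqr_integral_kernel_measure l : borel_measurable l ->
  sqr_integral PK l = (\int[P]_x (rnorm (weighted_section l x) ^+ 2)%:E)%E.
Proof.
move=> ml; rewrite /sqr_integral ge0_integral_density.
- by apply: eq_integral => x _; rewrite rnorm_weighted_section.
- by apply: measurable_funX; exact: measurable_rnorm.
- by move=> x; exact: sqr_ge0.
Qed.

Section one_weight.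
Variable l : X -> F.
Hypotheses (ml : borel_measurable l) (l2 : (sqr_integral PK l < +oo)%E).
Local Notation f := (weighted_section l).

Let sf : strongly_measurable f. Proof. exact: strongly_measurable_kernel. Qed.
Let mf : borel_measurable f. Proof. by case: sf. Qed.

Let integrable_sqr : P.-integrable [set: X] (EFin \o (fun x => rnorm (f x) ^+ 2)).
Proof.
apply/integrableP; split.
  by apply/measurable_EFinP/measurable_funX/measurable_rnorm.
under eq_integral do rewrite gee0_abs ?lee_fin ?sqr_ge0//.
by rewrite -sqr_integral_kernel_measure.
Qed.

Lemma integrable_weighted_section :
  P.-integrable [set: X] (fun x => (rnorm (f x))%:E).
Proof.
have i1 : P.-integrable [set: X] (EFin \o cst 1) by exact: finite_measure_integrable_cst.
apply: le_integrable (integrableD measurableT i1 integrable_sqr) => //.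
- exact/measurable_EFinP/measurable_rnorm.
- move=> x _ /=; rewrite lee_fin ger0_norm ?rnorm_ge0// (le_trans _ (ler_norm _))//.
  by have := rnorm_ge0 (f x); move: (rnorm _) => a a0; nra.
Qed.

Lemma bochner_integrable_weighted_section : bochner_integrable P f.
Proof.
split=> //; have /integrableP[_] := integrable_weighted_section.
by under [X in (X < _)%E -> _]eq_integral do rewrite gee0_abs ?lee_fin ?rnorm_ge0//.
Qed.

Lemma rdot_weighted_integral h :
  rdot (bochner_integral P f) h = \int[P]_x rdot (f x) h.
Proof.
have [_ fi] := bochner_integrable_weighted_section.
apply: rdot_bochner_integral => //.
exact: (bochner_integralP bochner_integrable_weighted_section).
Qed.

Lemma rnorm_weighted_integral :
  rnorm (bochner_integral P f) <= Num.sqrt (fine (sqr_integral PK l)).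
Proof.
have [_ fi] := bochner_integrable_weighted_section.
apply: le_trans (rnorm_bochner_integral mf fi
  (bochner_integralP bochner_integrable_weighted_section)) _.
set A := \int[P]_x _; have A0 : 0 <= A by apply: Rintegral_ge0 => x _; exact: rnorm_ge0.
rewrite -[leLHS]ger0_norm// -sqrtr_sqr; apply: ler_wsqrtr.
rewrite sqr_integral_kernel_measure//.
have iA : P.-integrable [set: X] (EFin \o (fun x => 2 * A * rnorm (f x))).
  exact: (integrableZl measurableT (2 * A) integrable_weighted_section).
have ic : P.-integrable [set: X] (EFin \o cst (A ^+ 2)).
  exact: finite_measure_integrable_cst.
(* Integrating [2 A a - A^2 <= a^2] at [a = rnorm (f x)], where [A] is the
   integral of [a], gives [A^2 <= \int a^2] because [P] has mass 1. *)
have : \int[P]_x (2 * A * rnorm (f x) - cst (A ^+ 2) x) <= \int[P]_x rnorm (f x) ^+ 2.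
  apply: le_Rintegral => //; first exact: integrableB iA ic.
  by move=> x _ /=; move: (rnorm _) => a; have := sqr_ge0 (a - A); nra.
rewrite RintegralB// RintegralZl//; last exact: integrable_weighted_section.
have P1 : fine (P [set: X]) = 1 by rewrite probability_setT.
rewrite Rintegral_cst// P1 mulr1 -/A => h.
by apply: le_trans h; rewrite le_eqVlt; apply/orP; left; apply/eqP; ring.
Qed.

End one_weight.

(** Paired with [h], the claim becomes additivity of real integrals, the scalar [a] having been
    moved onto [h]. *)
Lemma weighted_integral_linear (a : F) (l m : L2fun k PK) :
  bochner_integral P (weighted_section (a *: l + m)) =
  a *: bochner_integral P (weighted_section l) + bochner_integral P (weighted_section m).
Proof.
have /L2predP[ml l2] := L2valP l; have /L2predP[mm m2] := L2valP m.
have /L2predP[mlm lm2] := L2valP (a *: l + m).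
apply: rdot_inj => h; rewrite rdotDl rdotZlr !rdot_weighted_integral//.
have int (n : L2fun k PK) u :
    P.-integrable [set: X] (EFin \o (fun x => rdot (weighted_section n x) u)).
  have /L2predP[mn n2] := L2valP n.
  apply: integrable_rdot; last exact: integrable_weighted_section.
  by case: (bochner_integrable_weighted_section mn n2) => -[].
rewrite -RintegralD//; apply: eq_Rintegral => x _.
by rewrite -rdotZlr -rdotDl /weighted_section scalerA -scalerDl.
Qed.

(** Outside a [P]-null set, the weights can differ only where [K(x, x) = 0]; there [K_x = 0], and
    the integrands agree all the same. *)
Lemma weighted_integral_ae (l m : L2fun k PK) :
  {ae PK, forall x, l x = m x} ->
  bochner_integral P (weighted_section l) = bochner_integral P (weighted_section m).
Proof.
have /L2predP[ml l2] := L2valP l; have /L2predP[mm m2] := L2valP m.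
move=> /density_ae lm; apply: rdot_inj => h; rewrite !rdot_weighted_integral//.
have mint (n : L2fun k PK) :
    measurable_fun [set: X] (fun x => (rdot (weighted_section n x) h)%:E).
  have /L2predP[mn n2] := L2valP n; apply/measurable_EFinP/measurable_rdot.
  by case: (bochner_integrable_weighted_section mn n2) => -[].
congr fine; apply: ae_eq_integral => //.
apply: filterS lm => x + _; rewrite /weighted_section => -[->//|Kx0].
suff -> : rk_section H x = 0 by rewrite !scaler0.
by apply/eqP; rewrite -rnorm_eq0 -sqrf_eq0 rnorm_rk_section Kx0.
Qed.

Definition kernel_operator (u : L2 k PK) : H :=
  bochner_integral P (weighted_section (repr u)).

(** The operator is defined through the representative chosen by [repr]; this shows that any other
    representative gives the same value. *)
Lemma kernel_operatorE (l : L2fun k PK) :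
  kernel_operator (L2class l) = bochner_integral P (weighted_section l).
Proof. by apply: weighted_integral_ae; exact/L2classP/L2classK. Qed.

Lemma kernel_operator_linear : linear kernel_operator.
Proof.
move=> a u v; rewrite -{1}(L2classK v).
(* Scaling in [L2] is defined on the chosen representative, so this holds by computation. *)
have -> : a *: u = L2class (a *: repr u) by [].
by rewrite -L2classD kernel_operatorE weighted_integral_linear.
Qed.

Lemma rnorm_kernel_operator u : rnorm (kernel_operator u) <= L2norm u.
Proof.
have /L2predP[mu u2] := L2valP (repr u).
exact: rnorm_weighted_integral.
Qed.

End kernel_integral.

Theorem proposition3p1 (d : measure_display) (X : measurableType d)
    (R : realType) (k : scalar_kind) (P : probability X R) (H : rkhs R k X)
    (sepH : separable_set [set: H]) (mK : kernel_measurable H) :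
  let PK : {measure set X -> \bar R} := kernel_measure P mK in
  (forall l : X -> scalarF R k,
     borel_measurable l ->
     (\int[PK]_x (rnorm (l x) ^+ 2)%:E < +oo)%E ->
     let f := fun x => l x *: rk_section H x in
     bochner_integrable P f /\ is_bochner_integral P f (bochner_integral P f))
  /\
  (exists L : {linear L2 k PK -> H},
     [/\ forall l : L2fun k PK,
           L (L2class l) = bochner_integral P (fun x => l x *: rk_section H x),
         forall u : L2 k PK, rnorm (L u) <= L2norm u
       & exists C : R, forall u : L2 k PK, rnorm (L u) <= C * L2norm u]).
Proof.
move=> PK; split => [l ml l2 f|].
  have fi : bochner_integrable P f by exact: bochner_integrable_weighted_section ml l2.
  by split => //; exact: bochner_integralP.
pose lin := GRing.isLinear.Build _ _ _ _ _ (@kernel_operator_linear _ _ _ _ P H sepH mK).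
pose L : {linear L2 k PK -> H} := HB.pack (@kernel_operator _ _ _ _ P H mK) lin.
have LE u : rnorm (L u) <= L2norm u by exact: rnorm_kernel_operator.
exists L; split => //; first exact: kernel_operatorE.
by exists 1 => u; rewrite mul1r.
Qed.
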